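(* The chromatic number of the class of signed hexagonal grids is $4$; that is, every signed hexagonal grid $G$ satisfies $\chi_s(G)\le 4$, and some signed hexagonal grid has $\chi_s(G)=4$.
   Context: A signed graph $G=(V,E,s)$ is a finite simple graph (no loops, no parallel edges) with a signature $s:E\to\{-1,+1\}$ (positive and negative edges). Switching a vertex $v$ reverses the sign of every edge incident to $v$. A homomorphism of signed graphs $G\to H$ is a map $\varphi:V(G)\to V(H)$ such that, after switching some subset of the vertices of $G$, every edge $uv$ of $G$ is mapped to an edge $\varphi(u)\varphi(v)$ of $H$ with the same sign. The chromatic number $\chi_s(G)$ of a signed graph $G$ is the minimum order of a signed graph $H$ such that $G$ admits a homomorphism to $H$; the chromatic number of a class of signed graphs is the maximum of the chromatic numbers of its members. A hexagonal grid is a finite induced subgraph of the (infinite) graph of the tiling of the plane by regular hexagons; a signed hexagonal grid is a hexagonal grid with an arbitrary signature. *)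

(* Defs.v *)
From mathcomp Require Import all_boot all_order all_algebra.
From mathcomp Require Import boolp.
Set Implicit Arguments.
Unset Strict Implicit.
Unset Printing Implicit Defensive.
Import Order.TTheory GRing.Theory Num.Theory.

(* [sneg u v] says that the edge uv is negative; its value on pairs that are
   not edges is irrelevant and is never used. *)
Record signed_graph := SignedGraph {
  svertex :> finType;
  sedge : rel svertex;
  sneg : rel svertex;
  sedge_sym : symmetric sedge;
  sedge_irr : irreflexive sedge;
  sneg_sym : symmetric sneg
}.
Arguments sedge {s} _ _.
Arguments sneg {s} _ _.

Section Switching.
Variables (G : signed_graph) (S : {set G}).

(* Switching every vertex of S: an edge with both ends in S is reversed twice. *)
Definition switch_neg : rel G :=
  fun u v => sneg u v (+) (u \in S) (+) (v \in S).

Lemma switch_neg_sym : symmetric switch_neg.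
Proof. by move=> u v; rewrite /switch_neg sneg_sym addbAC. Qed.

Definition switch : signed_graph :=
  SignedGraph (@sedge_sym G) (@sedge_irr G) switch_neg_sym.

End Switching.

Definition sign_preserving (G H : signed_graph) (phi : G -> H) : Prop :=
  forall u v : G, sedge u v ->
    sedge (phi u) (phi v) /\ sneg (phi u) (phi v) = sneg u v.

Definition signed_hom (G H : signed_graph) (phi : G -> H) : Prop :=
  exists S : {set G}, @sign_preserving (switch S) H phi.

Definition hom_to_order (G : signed_graph) (k : nat) : Prop :=
  exists H : signed_graph, #|H| = k /\ exists phi : G -> H, signed_hom phi.

Lemma hom_to_order_ex (G : signed_graph) : exists k, `[< hom_to_order G k >].
Proof.
exists #|G|; apply/asboolP; exists G; split=> //; exists id, set0 => u v uv.
by split=> //; rewrite /= /switch_neg !in_set0 !addbF.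
Qed.

Definition chi_s (G : signed_graph) : nat := ex_minn (hom_to_order_ex G).

Definition class_chromatic_number (C : signed_graph -> Prop) (k : nat) : Prop :=
  (forall G, C G -> chi_s G <= k) /\ (exists G, C G /\ chi_s G = k).

(* Tiling of the plane by regular hexagons of side 1.  The pair (a, b) stands
   for the point a e1 + b e2, where e1 and e2 are unit vectors at an angle of
   60 degrees.  The hexagon centres form the lattice spanned by e1 + e2 and its
   image 2 e2 - e1 under the rotation by 60 degrees, both of length sqrt 3; the
   corners of the hexagon centred at c are the c + r^k e1, where r is that
   rotation and k is taken modulo 6. *)
Definition plane_point : Type := (int * int)%type.

Local Open Scope ring_scope.

Definition rot60 (p : plane_point) : plane_point := (- p.2, p.1 + p.2).

Definition hex_center (i j : int) : plane_point := (i - j, i + 2 * j).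

Definition hex_corner (i j : int) (k : nat) : plane_point :=
  let c := hex_center i j in
  let d := iter k rot60 (1, 0) in
  (c.1 + d.1, c.2 + d.2).

Definition hex_vertex (p : plane_point) : Prop :=
  exists i j k, p = hex_corner i j k.

Definition hex_adj (p q : plane_point) : Prop :=
  exists i j k,
    (p = hex_corner i j k /\ q = hex_corner i j k.+1) \/
    (q = hex_corner i j k /\ p = hex_corner i j k.+1).

Definition hexagonal_grid (V : finType) (e : rel V) : Prop :=
  exists pos : V -> plane_point,
    [/\ injective pos,
        forall v, hex_vertex (pos v)
      & forall u v, e u v <-> hex_adj (pos u) (pos v)].

Definition signed_hexagonal_grid (G : signed_graph) : Prop :=
  hexagonal_grid (@sedge G).

(* Main.v *)
Require Import Defs.
From mathcomp Require Import all_boot.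
From mathcomp Require Import all_algebra boolp zify.
Set Implicit Arguments.
Unset Strict Implicit.
Unset Printing Implicit Defensive.

(** Upper bound: take K4 with a single negative edge as target, and colour every
    vertex by its image together with the bit telling whether it is switched.
    From a given colour, walks of length two along edges with prescribed signs
    reach all but two of the eight colours, whereas a neighbour along a signed
    edge leaves three choices; hence two prescribed colours are always joined by
    a walk of length three with prescribed signs.  Drawn as a brick wall, the
    hexagonal grid can therefore be coloured row by row, each row from left to
    right.

    Lower bound: in a signed triangle every closed walk of length six is
    positive, so a hexagon with exactly one negative edge has no homomorphism to
    a signed graph of order at most three. *)

(** * Signed colourings of the brick wall *)

(** Among distinct pairs, only [(true, true)] and [(true, false)] both start with [true], so exactly
    one edge is negative. *)
Definition K4_neg (x y : bool * bool) : bool := x.1 && y.1.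

Definition K4 : signed_graph.
Proof.
refine (@SignedGraph (bool * bool)%type (fun x y => x != y) K4_neg _ _ _).
- by move=> x y; rewrite eq_sym.
- by move=> x; rewrite eqxx.
- by move=> x y; rewrite /K4_neg andbC.
Defined.

Definition colour : Type := bool * bool * bool.

Definition compat (s : bool) (x y : colour) : bool :=
  (x.1 != y.1) && (s (+) x.2 (+) y.2 == K4_neg x.1 y.1).

Lemma compatC s x y : compat s x y = compat s y x.
Proof. by case: s x y => [] [[[] []] []] [[[] []] []]. Qed.

Lemma compat_walk3 (s1 s2 s3 : bool) (x z : colour) :
  exists y1 y2, [/\ compat s1 x y1, compat s2 y1 y2 & compat s3 z y2].
Proof.
pose bs := [:: true; false].
pose cs : seq colour := [seq (p, c) | p <- [seq (a, b) | a <- bs, b <- bs], c <- bs].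
have /hasP[y1 _ /hasP[y2 _ /and3P[? ? ?]]] : has (fun y1 => has (fun y2 =>
    [&& compat s1 x y1, compat s2 y1 y2 & compat s3 z y2]) cs) cs.
  by case: s1 s2 s3 x z => [] [] [] [[[] []] []] [[[] []] []].
by exists y1, y2.
Qed.

(** Serves twice: to extend a row column by column, and to stack whole rows. *)
Lemma dependent_choice_inv (T : Type) (P : nat -> T -> Prop)
    (R : nat -> T -> T -> Prop) :
  (exists x, P 0 x) ->
  (forall n x, P n x -> exists y, P n.+1 y /\ R n x y) ->
  exists f : nat -> T, forall n, P n (f n) /\ R n (f n) (f n.+1).
Proof.
move=> /cid[x0 Px0] step.
pose next n (s : {x | P n x}) : {y | P n.+1 y /\ R n (sval s) y} :=
  cid (step n (sval s) (svalP s)).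
pose fix f n : {x | P n x} := if n is m.+1
  then exist _ (sval (next m (f m))) (svalP (next m (f m))).1
  else exist _ x0 Px0.
exists (fun n => sval (f n)) => n; split; first exact: svalP.
exact: (svalP (next n (f n))).2.
Qed.

(* The invariant at a column without a vertical edge asks for one step of
   lookahead, since the next column has such an edge. *)
Lemma brick_row (o : bool) (below : nat -> colour) (sh sv : nat -> bool) :
  exists row : nat -> colour, forall c,
    compat (sh c) (row c) (row c.+1) /\
    (odd c = o -> compat (sv c) (below c) (row c)).
Proof.
pose P c x := if odd c == o then is_true (compat (sv c) (below c) x)
  else exists w, compat (sh c) x w && compat (sv c.+1) (below c.+1) w.
have [||row rowP] := @dependent_choice_inv colour P (fun c x y => compat (sh c) x y).
- have [y1 [y2 [w1 w2 w3]]] :=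
    compat_walk3 (sv 0) (sh 0) (sv 1) (below 0) (below 1).
  rewrite /P; case: (odd 0 == o); exists y1; first exact: w1.
  by exists y2; rewrite w2 w3.
- move=> c x; rewrite /P; case: (eqVneq (odd c) o) => [<- _ | co [w /andP[xw bw]]].
    (* The walk goes from column [c] through [c.+1] and [c.+2], then down to the vertex below; [y2]
       is the lookahead witness for [y1]. *)
    have [y1 [y2 [w1 w2 w3]]] :=
      compat_walk3 (sh c) (sh c.+1) (sv c.+2) x (below c.+2).
    exists y1; split=> //; rewrite /= ifF; last by case: odd.
    by exists y2; rewrite w2 w3.
  by exists w; split=> //; rewrite ifT //=; move: co; case: odd; case: (o).
- exists row => c; have [Pc Rc] := rowP c; split=> // co.
  by move: Pc; rewrite /P co eqxx.
Qed.

Definition brick_edge (p q : nat * nat) : Prop :=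
  (q = (p.1.+1, p.2)) \/ (q = (p.1, p.2.+1) /\ odd p.1 = odd p.2).

Lemma brick_wall_colouring (neg : rel (nat * nat)) :
  exists col : nat * nat -> colour,
    forall p q, brick_edge p q -> compat (neg p q) (col p) (col q).
Proof.
have [||f fP] := @dependent_choice_inv (nat -> colour)
  (fun r f => forall c, compat (neg (c, r) (c.+1, r)) (f c) (f c.+1))
  (fun r f g => forall c, odd c = odd r -> compat (neg (c, r) (c, r.+1)) (f c) (g c)).
(* Nothing lies below the bottom row, so the parity, the colours below and the vertical signs are
   placeholders. *)
- have [row rowP] := brick_row true (fun=> (false, false, false))
    (fun c => neg (c, 0) (c.+1, 0)) (fun=> false).
  by exists row => c; case: (rowP c).
- move=> r f _; have [row rowP] := brick_row (odd r) f
    (fun c => neg (c, r.+1) (c.+1, r.+1)) (fun c => neg (c, r) (c, r.+1)).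
  by exists row; split=> c; case: (rowP c).
exists (fun p => f p.2 p.1) => -[c r] q [-> | [-> cr]] /=.
  by have [+ _] := fP r; apply.
by have [_ +] := fP r; apply.
Qed.

(** * The hexagonal tiling as a brick wall *)

Section HexagonalTiling.
Local Open Scope ring_scope.

Lemma iter_rot60_period k : iter (k + 6) rot60 (1, 0) = iter k rot60 (1, 0).
Proof.
by rewrite iterD; congr (iter k rot60 _); rewrite /rot60 /=; congr pair; lia.
Qed.

Lemma hex_corner_period i j k : hex_corner i j (k + 6) = hex_corner i j k.
Proof. by rewrite /hex_corner iter_rot60_period. Qed.

Lemma hex_corner_lt6 i j k : exists2 l, (l < 6)%N &
  hex_corner i j k = hex_corner i j l /\ hex_corner i j k.+1 = hex_corner i j l.+1.
Proof.
elim/ltn_ind: k => k IH; have [lt6|ge6] := ltnP k 6; first by exists k.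
have [|l l6 [e1 e2]] := IH (k - 6)%N; first lia.
exists l => //; rewrite -e1 -e2.
rewrite -(hex_corner_period i j (k - 6)).
by rewrite -(hex_corner_period i j (k - 6).+1) addSn subnK.
Qed.

(* The first coordinate increases by one along the rows, which follow the steps
   e1 and e2 alternately; the points of row [r] have [a - b = 3 r + 1] or
   [3 r + 2], and vertical edges cross the lines [a - b = 3 r].  The shift by [M]
   makes both coordinates natural numbers on a finite grid. *)
Definition brick_pos (M : nat) (p : plane_point) : nat * nat :=
  (absz (p.1 + p.2 + (2 * M)%:Z), (absz (p.1 - p.2 + (6 * M)%:Z)%R %/ 3)%N).

Definition bounded (M : nat) (p : plane_point) : Prop :=
  (`|p.1| + `|p.2| <= M)%N.

(** At a centre [a - b] is [- 3 j], and the six unit steps to the corners change it by 1 or 2 in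
    absolute value. *)
Lemma hex_vertexE p : hex_vertex p -> exists n t : int,
  p.1 - p.2 = 3 * n + t /\ (t = 1 \/ t = 2).
Proof.
move=> [i [j [k ->]]]; have [l l6 [-> _]] := hex_corner_lt6 i j k.
case: l l6 => [|[|[|[|[|[|l]]]]]] // _; rewrite /hex_corner /hex_center /rot60 /=.
- by exists (- j), 1; split; [lia | left].
- by exists (- j - 1), 2; split; [lia | right].
- by exists (- j - 1), 1; split; [lia | left].
- by exists (- j - 1), 2; split; [lia | right].
- by exists (- j), 1; split; [lia | left].
- by exists (- j), 2; split; [lia | right].
Qed.

(** The row gives [n] and the column gives [a + b]; the parity of [a + b], equal to that of [a - b],
    then decides [t]. *)
Lemma brick_pos_inj M p q : bounded M p -> bounded M q ->
  hex_vertex p -> hex_vertex q -> brick_pos M p = brick_pos M q -> p = q.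
Proof.
case: p q => [a b] [a' b']; rewrite /bounded /brick_pos /=.
move=> Mp Mq /hex_vertexE/= [n [t [e ht]]] /hex_vertexE/= [n' [t' [e' ht']]] [h1 h2].
by congr pair; lia.
Qed.

(** Sides 0 and 3 of a hexagon keep [a + b] and cross a line [a - b = 3 r]; the other four change
    [a + b] by one inside a row. *)
Lemma hex_adj_brick M p q : bounded M p -> bounded M q -> hex_adj p q ->
  brick_edge (brick_pos M p) (brick_pos M q) \/
  brick_edge (brick_pos M q) (brick_pos M p).
Proof.
wlog [i [j [k [-> ->]]]] : p q / exists i j k,
    p = hex_corner i j k /\ q = hex_corner i j k.+1.
  move=> H Mp Mq [i [j [k pq]]]; case: pq => [pq|qp].
    by apply: H => //; exists i, j, k; [|left].
  have adj : hex_adj q p by exists i, j, k; left.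
  have [] := H q p _ Mq Mp adj; first by exists i, j, k.
    by right.
  by left.
have [l l6 [-> ->]] := hex_corner_lt6 i j k => + + _.
case: l l6 => [|[|[|[|[|[|l]]]]]] // _;
  rewrite /bounded /brick_edge /brick_pos /hex_corner /hex_center /rot60 /= => M1 M2.
- right; right; split; first congr pair; lia.
- right; left; congr pair; lia.
- right; left; congr pair; lia.
- left; right; split; first congr pair; lia.
- left; left; congr pair; lia.
- left; left; congr pair; lia.
Qed.

Lemma hex_adj_sym p q : hex_adj p q -> hex_adj q p.
Proof. by move=> [i [j [k [pq|qp]]]]; exists i, j, k; [right|left]. Qed.

Lemma hex_adj_irr p : ~ hex_adj p p.
Proof.
suff H i j k : hex_corner i j k = hex_corner i j k.+1 -> False.
  by move=> [i [j [k [[e e']|[e e']]]]]; apply: (H i j k); rewrite -e -e'.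
have [l l6 [-> ->]] := hex_corner_lt6 i j k.
by case: l l6 => [|[|[|[|[|[|l]]]]]] // _; rewrite /hex_corner /= => -[]; lia.
Qed.

End HexagonalTiling.

Lemma signed_hexagonal_grid_hom_K4 (G : signed_graph) :
  signed_hexagonal_grid G -> hom_to_order G 4.
Proof.
move=> [pos [pos_inj pos_hex pos_adj]].
pose F (v : G) := (`|(pos v).1| + `|(pos v).2|)%N.
pose M := \max_v F v.
have posM v : bounded M (pos v) by exact: (@leq_bigmax _ F v).
pose bp v := brick_pos M (pos v).
have bp_inj : injective bp.
  by move=> u v /(brick_pos_inj (posM u) (posM v) (pos_hex u) (pos_hex v)) /pos_inj.
(* Signs are carried over to brick positions, unambiguously since [bp] is injective. *)
pose neg p q := [exists u : G, exists v : G, [&& bp u == p, bp v == q & sneg u v]].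
have negE u v : neg (bp u) (bp v) = sneg u v.
  apply/existsP/idP => [[x /existsP[y /and3P[/eqP/bp_inj-> /eqP/bp_inj->]]] //|uv].
  by exists u; apply/existsP; exists v; rewrite !eqxx.
have [col colP] := brick_wall_colouring neg.
exists K4; split; first by rewrite card_prod card_bool.
exists (fun v => (col (bp v)).1), [set v | (col (bp v)).2] => u v /= uv.
have : compat (@sneg G u v) (col (bp u)) (col (bp v)).
  have [e|e] := hex_adj_brick (posM u) (posM v) ((pos_adj u v).1 uv).
    by rewrite -negE; exact: colP.
  by rewrite sneg_sym -negE compatC; exact: colP.
by rewrite /compat /switch_neg !inE => /andP[? /eqP ->].
Qed.

(** * A hexagon with one negative edge *)

Definition hexagon_pos (v : 'I_6) : plane_point := hex_corner 0 0 v.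

(* The only negative edge joins the corners 0 and 5. *)
Definition hexagon_neg : rel 'I_6 :=
  fun u v => (u + v == 5) && ((u == 0 :> nat) || (v == 0 :> nat)).

Definition hexagon : signed_graph.
Proof.
refine (@SignedGraph 'I_6 (fun u v => `[< hex_adj (hexagon_pos u) (hexagon_pos v) >])
  hexagon_neg _ _ _).
- by move=> u v; apply/asboolP/asboolP; apply: hex_adj_sym.
- by move=> u; apply/asboolP; apply: hex_adj_irr.
- by move=> u v; rewrite /hexagon_neg addnC orbC.
Defined.

Lemma hexagon_grid : signed_hexagonal_grid hexagon.
Proof.
exists hexagon_pos; split.
- move=> [u hu] [v hv]; rewrite /hexagon_pos /= => e; apply/val_inj => /=.
  case: u v hu hv e => [|[|[|[|[|[|u]]]]]] [|[|[|[|[|[|v]]]]]] // _ _;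
    by rewrite /hex_corner /= => -[]; lia.
- by move=> v; exists 0%R, 0%R, v.
- by move=> u v; split=> /asboolP.
Qed.

Lemma hexagon_edge (u v : hexagon) : val v = (val u).+1 %% 6 -> sedge u v.
Proof.
case: u v => [u hu] [v hv] /= e; apply/asboolP; exists 0%R, 0%R, u; left.
split=> //; rewrite /hexagon_pos /= e.
by case: u hu {e} => [|[|[|[|[|[|u]]]]]].
Qed.

(** Six steps wind round a triangle zero or two times, so each edge is crossed an even number of
    times and its signs cancel. *)
Lemma triangle_closed_walk6 (T : finType) (neg : rel T) (x0 x1 x2 x3 x4 x5 : T) :
  #|T| < 4 -> symmetric neg ->
  x0 != x1 -> x1 != x2 -> x2 != x3 -> x3 != x4 -> x4 != x5 -> x5 != x0 ->
  neg x0 x1 (+) neg x1 x2 (+) neg x2 x3 (+) neg x3 x4 (+) neg x4 x5 (+) neg x5 x0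
    = false.
Proof.
move=> T4 neg_sym.
have other (a b x y : T) : a != b -> x != a -> x != b -> y != a -> y != b -> x = y.
  move=> ab xa xb ya yb; apply/eqP; apply: contraLR T4 => xy; rewrite -leqNgt.
  have <- : #|[set a; b; x; y]| = 4.
    by rewrite -!setUA !cardsU1 cards1 !inE !negb_or ab xy
      ![a == _]eq_sym ![b == _]eq_sym xa xb ya yb.
  exact: max_card.
(* If the walk turns back at [x1], then [x4 = x0] or [x3 = x5], and every edge is retraced. *)
have [->|x20] := eqVneq x2 x0.
  have [->|x40] := eqVneq x4 x0 => ? ? x03 x34 x45 x50.
    by rewrite (neg_sym x1) (neg_sym x3) (neg_sym x5) addbb -addbA addbb addbF addbb.
  rewrite (other x0 x4 x3 x5) // 1?eq_sym // (neg_sym x1) (neg_sym x4) (neg_sym x5 x0).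
  by case: (neg x0 x1); case: (neg x0 x5); case: (neg x5 x4).
move=> x01 x12.
have third z : [\/ z = x0, z = x1 | z = x2].
  have [->|z0] := eqVneq z x0; first by constructor 1.
  have [->|z1] := eqVneq z x1; first by constructor 2.
  by constructor 3; apply: (other x0 x1) => //; rewrite eq_sym.
case: (third x3) => ->; rewrite ?eqxx // => _;
  case: (third x4) => ->; rewrite ?eqxx // => _;
  case: (third x5) => ->; rewrite ?eqxx // => _ _;
  rewrite ?(neg_sym x1 x0) ?(neg_sym x2 x0) ?(neg_sym x2 x1);
  by case: (neg x0 x1); case: (neg x0 x2); case: (neg x1 x2).
Qed.

Lemma hexagon_not_hom3 k : k < 4 -> ~ hom_to_order hexagon k.
Proof.
move=> k4 [H [Hk [phi [S phiP]]]].
pose v i : hexagon := inord i : 'I_6.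
have vK i : i < 6 -> val (v i) = i by move=> ?; exact: inordK.
have step i j : i < 6 -> j = i.+1 %% 6 -> phi (v i) != phi (v j) /\
    sneg (phi (v i)) (phi (v j)) = switch_neg S (v i) (v j).
  move=> i6 ij; have j6 : j < 6 by rewrite ij ltn_pmod.
  have [|pe ps] := phiP (v i) (v j); first by apply: hexagon_edge; rewrite !vK.
  by split=> //; apply: contraTneq pe => ->; rewrite sedge_irr.
have [d01 n01] := step 0 1 isT erefl; have [d12 n12] := step 1 2 isT erefl.
have [d23 n23] := step 2 3 isT erefl; have [d34 n34] := step 3 4 isT erefl.
have [d45 n45] := step 4 5 isT erefl; have [d50 n50] := step 5 0 isT erefl.
have := triangle_closed_walk6 _ (@sneg_sym H) d01 d12 d23 d34 d45 d50.
rewrite Hk n01 n12 n23 n34 n45 n50 /switch_neg /= /hexagon_neg !vK //= => /(_ k4).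
(* Each corner lies on two sides, so the switches cancel and one negative sign remains. *)
by do 6!case: (v _ \in S).
Qed.

Theorem theorem2 : class_chromatic_number signed_hexagonal_grid 4.
Proof.
have le4 G : signed_hexagonal_grid G -> chi_s G <= 4.
  move=> /signed_hexagonal_grid_hom_K4 G4; rewrite /chi_s.
  by case: ex_minnP => m _; apply; apply/asboolP.
split=> //; exists hexagon; split; first exact: hexagon_grid.
apply/eqP; rewrite eqn_leq le4 /=; last exact: hexagon_grid.
rewrite /chi_s; case: ex_minnP => m /asboolP hm _.
by rewrite leqNgt; apply/negP => /hexagon_not_hom3.
Qed.
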